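(* For every integer $k\geq 1$ and every $1\leq p\leq\infty$ there exists a constant $C_{k,p}$, depending only on $k$ and $p$, such that for every finite subset $A\subset\mathbb{Z}$ with characteristic function $\chi_A$, $$\|(\mathcal{M}^d\chi_A)^{(k)}\|_{l^p(\mathbb{Z})}\leq C_{k,p}\,\|\chi_A^{(k)}\|_{l^p(\mathbb{Z})}.$$
   Context: For $f:\mathbb{Z}\to\mathbb{R}$ and an integer $k\geq 1$, the discrete derivative (forward difference) of order $k$ is $f^{(k)}(n):=\sum_{j=0}^{k}\binom{k}{j}(-1)^{j}f(n+k-j)$, $n\in\mathbb{Z}$. The discrete centered Hardy-Littlewood maximal function of $f:\mathbb{Z}\to\mathbb{R}$ is $$\mathcal{M}^d f(n):=\sup_{r\in\mathbb{Z}^+}\frac{1}{2r+1}\sum_{j=-r}^{r}|f(n+j)|,\qquad n\in\mathbb{Z},$$ where $\mathbb{Z}^+$ denotes the set of nonnegative integers. *)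

(* Defs.v *)
From HB Require Import structures.
From mathcomp Require Export all_boot all_order all_algebra.
From mathcomp Require Export all_classical all_reals all_analysis.

Set Implicit Arguments.
Unset Strict Implicit.
Unset Printing Implicit Defensive.

Import Order.TTheory GRing.Theory Num.Theory.

Local Open Scope classical_set_scope.
Local Open Scope ring_scope.

(* The library puts the discrete sigma-algebra on nat, but not on int. *)
HB.instance Definition _ := isPointed.Build int 0.
HB.instance Definition _ := @isMeasurable.Build default_measure_display
  int discrete_measurable discrete_measurable0
  discrete_measurableC discrete_measurableU.

Definition fdiff (R : realType) (k : nat) (f : int -> R) (n : int) : R :=
  \sum_(j < k.+1) 'C(k, j)%:R * (-1) ^+ j * f (n + k%:Z - j%:Z).

(* The indices n - r, ..., n + r are written n - r + i with 0 <= i <= 2 r. *)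
Definition centered_avg (R : realType) (f : int -> R) (n : int) (r : nat) : R :=
  (r.*2.+1)%:R^-1 * \sum_(i < r.*2.+1) `|f (n - r%:Z + i%:Z)|.

(* The supremum is taken in R, so it is the intended one only when the
   averages at n are bounded, which is the case for every bounded f. *)
Definition centered_maximal (R : realType) (f : int -> R) (n : int) : R :=
  sup (range (centered_avg f n)).

Definition lpnorm (R : realType) (p : \bar R) (f : int -> R) : \bar R :=
  Lnorm (@counting int R) p (EFin \o f).

(* Main.v *)
Require Import Defs.
From mathcomp Require Import ring lra zify.
From mathcomp Require Import ess_sup_inf.
From mathcomp Require finmap.

(** Everything reduces to one estimate: on any window of integers, the total
    variation of M chi_A, where M is the centered maximal operator, is at most
    4 N + 3, where N is the number of jumps of chi_A in the window
    ([variation_centered_maximal_indic]).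

    The estimate is local.  On a run of A, M chi_A is constantly 1.  On a gap
    m, ..., m + n of the complement, the intervals centered at a point x of the
    gap are of three kinds.  Those that do not go beyond m + n only see the
    part of A on the left, those that do not go before m only see the part on
    the right, and the other ones have length greater than n.  The maximal
    function of the left part of A decreases along the gap, because when x
    moves one step to the right an interval that still reaches A must get
    longer without gaining any point of A; symmetrically, the one of the right
    part increases.  An average over a long interval moves by at most
    1 / (n + 1) when x moves by one.  Both monotone functions take their values
    in [0, 1], and there are n steps, so the variation on the gap is at
    most 3 ([variation_in_gap]).  Gluing the runs and gaps together costs at
    most 3 + 1 for each jump.

    It remains to relate first differences to k-th ones.  On the side of
    M chi_A, each further difference at most doubles both the l^1 norm and the
    sup norm, and t ^ p <= B ^ p t for 0 <= t <= B and 1 <= B turns l^1 bounds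
    into l^p bounds.  On the side of chi_A, all differences are integers, so
    a nonzero one has absolute value at least 1; and if the k-th difference
    vanishes on a long enough run then so does the first one
    ([fdiff_vanish_run]), since a bounded function cannot have a nonzero integer
    slope for long.  Hence each jump of chi_A is followed, within a distance
    depending on k only, by a point where the k-th difference contributes at
    least 1 to the p-th power sum.  A nonempty finite set has at least one
    jump, which absorbs the additive constant 3, and also settles p = oo,
    where the two norms lie in [0, 2 ^ k] and [1, oo]. *)

Set Implicit Arguments.
Unset Strict Implicit.
Unset Printing Implicit Defensive.

Import Order.TTheory GRing.Theory Num.Theory.

Local Open Scope classical_set_scope.
Local Open Scope ring_scope.

(** * Iterated forward differences *)

Section Differences.
Context {R : realType}.
Implicit Types (f : int -> R) (k n : nat) (m x : int).

Lemma fdiff0 f x : fdiff 0 f x = f x.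
Proof. by rewrite /fdiff big_ord1 bin0 expr0 !mul1r addr0 subr0. Qed.

Lemma fdiffS k f x : fdiff k.+1 f x = fdiff k f (x + 1) - fdiff k f x.
Proof.
rewrite /fdiff big_ord_recl bin0.
rewrite (eq_bigr (fun i : 'I_k.+1 =>
    'C(k, i.+1)%:R * (-1) ^+ i.+1 * f (x + k%:Z - i%:Z) +
    'C(k, i)%:R * (-1) ^+ i.+1 * f (x + k%:Z - i%:Z))); last first.
  move=> i _; rewrite lift0 binS natrD !mulrDl.
  by have -> : x + k.+1%:Z - i.+1%:Z = x + k%:Z - i%:Z by lia.
rewrite big_split /= big_ord_recr /= bin_small// mul0r mul0r addr0.
rewrite [in RHS]big_ord_recl /= bin0 addrA; congr (_ + _ + _).
- by congr (_ * f _); lia.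
- rewrite addr0; apply: eq_bigr => i _; rewrite /bump leq0n add1n.
  by congr (_ * f _); lia.
- rewrite -sumrN; apply: eq_bigr => i _; rewrite exprS mulN1r mulrN mulNr.
  by congr (- (_ * f _)); lia.
Qed.

Lemma fdiff1 f x : fdiff 1 f x = f (x + 1) - f x.
Proof. by rewrite fdiffS !fdiff0. Qed.

Lemma fdiff_bound k f x : (forall y, `|f y| <= 1) -> `|fdiff k f x| <= 2 ^+ k.
Proof.
move=> f1; elim: k x => [x|k IHk x]; first by rewrite fdiff0.
rewrite fdiffS exprS mulr_natl mulr2n (le_trans (ler_normB _ _))//.
exact: lerD.
Qed.

Lemma fdiff_int k f x :
  (forall y, f y \is a Num.int) -> fdiff k f x \is a Num.int.
Proof.
move=> fZ; elim: k x => [x|k IHk x]; first by rewrite fdiff0.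
by rewrite fdiffS rpredB.
Qed.

Lemma sum_fdiff_le k f (V : R) :
  (forall m n, \sum_(i < n) `|fdiff 1 f (m + i%:Z)| <= V) ->
  forall m n, \sum_(i < n) `|fdiff k.+1 f (m + i%:Z)| <= 2 ^+ k * V.
Proof.
move=> fV; elim: k => [|k IHk] m n; first by rewrite mul1r.
rewrite exprS -mulrA mulr_natl mulr2n.
apply: le_trans (lerD (IHk (m + 1) n) (IHk m n)).
rewrite -big_split; apply: ler_sum => i _ /=.
by rewrite fdiffS addrAC ler_normB.
Qed.

Lemma constant_run (h : int -> R) m n :
  (forall i, (i < n)%N -> h (m + i%:Z + 1) = h (m + i%:Z)) ->
  forall i, (i <= n)%N -> h (m + i%:Z) = h m.
Proof.
move=> hc; elim=> [_|i IHi lein]; first by rewrite addr0.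
by rewrite -IHi ?(ltnW lein)// -(hc i)//; congr h; lia.
Qed.

(** If the difference of order k + 2 vanishes on the run, the one of order
    k + 1 is a constant integer c there, so the one of order k is affine of
    slope c; being bounded by 2 ^ k, it forces c = 0 once the run is longer
    than 2 ^ (k + 1), and the order goes down by one. *)
Lemma fdiff_vanish_run k n f m :
    (forall y, `|f y| <= 1) -> (forall y, f y \is a Num.int) ->
    (2 ^ k < n)%N ->
    (forall i, (i < n)%N -> fdiff k.+1 f (m + i%:Z) = 0) ->
  forall i, (i < n)%N -> fdiff 1 f (m + i%:Z) = 0.
Proof.
move=> f1 fZ; elim: k => // k IHk len f0; apply: IHk.
  by rewrite (leq_trans _ len)// ltnS leq_exp2l.
have g_cst i : (i <= n)%N -> fdiff k.+1 f (m + i%:Z) = fdiff k.+1 f m.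
  apply: constant_run => j ltjn; apply/eqP; rewrite -subr_eq0 -fdiffS.
  by rewrite f0.
suff c0 : fdiff k.+1 f m = 0 by move=> i /ltnW /g_cst ->.
have lin i : (i <= n)%N ->
    fdiff k f (m + i%:Z) = fdiff k f m + i%:R * fdiff k.+1 f m.
  elim: i => [_|i IHi lein]; first by rewrite addr0 mul0r addr0.
  have -> : m + i.+1%:Z = m + i%:Z + 1 by lia.
  rewrite -natr1 mulrDl mul1r addrA -IHi ?(ltnW lein)//.
  by rewrite -(g_cst i) ?(ltnW lein)// fdiffS; ring.
(* |c| n = |fdiff k f (m + n) - fdiff k f m| <= 2 ^ (k + 1) < n *)
apply/eqP/negPn/negP => c_neq0.
have c_ge1 := norm_intr_ge1 (fdiff_int k.+1 m fZ) c_neq0.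
have : n%:R * `|fdiff k.+1 f m| <= 2 ^+ k.+1.
  rewrite -[n%:R]normr_nat -normrM.
  have -> : n%:R * fdiff k.+1 f m = fdiff k f (m + n%:Z) - fdiff k f m.
    by rewrite lin// addrC addKr.
  rewrite exprS mulr_natl mulr2n (le_trans (ler_normB _ _))//.
  by rewrite lerD ?fdiff_bound.
apply/negP; rewrite -ltNge -natrX.
apply: (@lt_le_trans _ _ n%:R); first by rewrite ltr_nat.
by rewrite ler_peMr.
Qed.

End Differences.

(** * The centered maximal function on a gap *)

Section MaximalFunction.
Context {R : realType}.
Implicit Types (f g : int -> R) (m x y : int) (n r : nat).

Lemma centered_avg_ge0 f x r : 0 <= centered_avg f x r.
Proof. by rewrite mulr_ge0// sumr_ge0. Qed.

Lemma le_centered_avg f g x r :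
  (forall y, x - r%:Z <= y <= x + r%:Z -> `|f y| <= `|g y|) ->
  centered_avg f x r <= centered_avg g x r.
Proof.
move=> fg; rewrite ler_wpM2l// ler_sum// => i _; apply: fg.
by have := ltn_ord i; lia.
Qed.

Lemma centered_avg_le1 f x r : (forall y, `|f y| <= 1) ->
  centered_avg f x r <= 1.
Proof.
move=> f1; rewrite ler_pdivrMl ?ltr0n// mulr1.
by rewrite (le_trans (ler_sum _ (fun i _ => f1 _)))// sumr_const card_ord.
Qed.

Lemma centered_avg_le_maximal f x r : (forall y, `|f y| <= 1) ->
  centered_avg f x r <= centered_maximal f x.
Proof.
move=> f1; apply: ub_le_sup; last by exists r.
by exists 1 => _ [s _ <-]; exact: centered_avg_le1.
Qed.

Lemma centered_maximal_le f x (c : R) : (forall r, centered_avg f x r <= c) ->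
  centered_maximal f x <= c.
Proof.
move=> fc; apply: ge_sup; first by exists (centered_avg f x 0), 0%N.
by move=> _ [r _ <-].
Qed.

Lemma centered_maximal_ge0 f x : (forall y, `|f y| <= 1) ->
  0 <= centered_maximal f x.
Proof.
by move=> f1; rewrite (le_trans (centered_avg_ge0 f x 0))//
  centered_avg_le_maximal.
Qed.

Lemma centered_maximal_le1 f x : (forall y, `|f y| <= 1) ->
  centered_maximal f x <= 1.
Proof.
by move=> f1; apply: centered_maximal_le => r; exact: centered_avg_le1.
Qed.

Lemma centered_maximal_eq1 f x : (forall y, `|f y| <= 1) -> f x = 1 ->
  centered_maximal f x = 1.
Proof.
move=> f1 fx; apply/eqP; rewrite eq_le centered_maximal_le1//=.
apply: le_trans (centered_avg_le_maximal x 0 f1).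
by rewrite /centered_avg big_ord1 invr1 mul1r subr0 addr0 fx normr1.
Qed.

Lemma le_centered_maximal f g x : (forall y, `|g y| <= 1) ->
  (forall y, `|f y| <= `|g y|) -> centered_maximal f x <= centered_maximal g x.
Proof.
move=> g1 fg; apply: centered_maximal_le => r.
by apply: le_trans (centered_avg_le_maximal x r g1); apply: le_centered_avg.
Qed.

(** Moving the center by one trades a single point of the interval for
    another one. *)
Lemma centered_avg_lipschitz f x r : (forall y, `|f y| <= 1) ->
  `|centered_avg f (x + 1) r - centered_avg f x r| <= (r.*2.+1)%:R^-1.
Proof.
move=> f1; rewrite /centered_avg -mulrBr normrM normfV normr_nat.
rewrite ler_piMr ?invr_ge0//.
rewrite big_ord_recr [X in _ - X]big_ord_recl /=.
set s := \sum_(i < r.*2) _; set t := \sum_(i < r.*2) _.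
have -> : t = s.
  by apply: eq_bigr => i _; congr `|f _|; rewrite /bump leq0n add1n; lia.
set a := `|f _|; set b := `|f _|.
have [a0 b0 a1 b1] : [/\ 0 <= a, 0 <= b, a <= 1 & b <= 1].
  by split; [exact: normr_ge0|exact: normr_ge0|exact: f1|exact: f1].
by rewrite ler_norml; apply/andP; split; lra.
Qed.

(** Both intervals have the same left end, and the points of the longer one
    that are missing from the shorter one lie in the region where f vanishes. *)
Lemma centered_avg_right_of_support f m x r :
  (forall y, m <= y -> f y = 0) -> m <= x ->
  centered_avg f (x + 1) r.+1 <= centered_avg f x r.
Proof.
move=> f0 mx; rewrite /centered_avg doubleS.
rewrite 2!big_ord_recr /= !f0; try lia.
rewrite normr0 !addr0 ler_pM ?sumr_ge0//.
  by rewrite lef_pV2 ?posrE ?ltr0n// ler_nat; lia.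
apply: ler_sum => i _.
by rewrite le_eqVlt; apply/orP; left; apply/eqP; congr `|f _|; lia.
Qed.

Lemma centered_avg_left_of_support f m x r :
  (forall y, y <= m -> f y = 0) -> x + 1 <= m ->
  centered_avg f x r.+1 <= centered_avg f (x + 1) r.
Proof.
move=> f0 mx; rewrite /centered_avg doubleS.
rewrite 2!big_ord_recl /= !f0; try (rewrite ?/bump; lia).
rewrite normr0 !add0r ler_pM ?sumr_ge0//.
  by rewrite lef_pV2 ?posrE ?ltr0n// ler_nat; lia.
apply: ler_sum => i _; rewrite le_eqVlt; apply/orP; left; apply/eqP.
by congr `|f _|; rewrite /bump; lia.
Qed.

Lemma centered_avg0 f x : centered_avg f x 0 = `|f x|.
Proof. by rewrite /centered_avg big_ord1 invr1 mul1r subr0 addr0. Qed.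

Lemma centered_maximal_right_of_support f m x : (forall y, `|f y| <= 1) ->
  (forall y, m <= y -> f y = 0) -> m <= x ->
  centered_maximal f (x + 1) <= centered_maximal f x.
Proof.
move=> f1 f0 mx; apply: centered_maximal_le => -[|r].
  by rewrite centered_avg0 f0 ?normr0 ?centered_maximal_ge0//; lia.
apply: le_trans (centered_avg_right_of_support r f0 mx) _.
exact: centered_avg_le_maximal.
Qed.

Lemma centered_maximal_left_of_support f m x : (forall y, `|f y| <= 1) ->
  (forall y, y <= m -> f y = 0) -> x + 1 <= m ->
  centered_maximal f x <= centered_maximal f (x + 1).
Proof.
move=> f1 f0 mx; apply: centered_maximal_le => -[|r].
  by rewrite centered_avg0 f0 ?normr0 ?centered_maximal_ge0//; lia.
apply: le_trans (centered_avg_left_of_support r f0 mx) _.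
exact: centered_avg_le_maximal.
Qed.

Definition left_part m f y : R := if y < m then f y else 0.
Definition right_part m f y : R := if m < y then f y else 0.

Lemma left_part_le m f y : `|left_part m f y| <= `|f y|.
Proof. by rewrite /left_part; case: ifP; rewrite ?normr0. Qed.

Lemma right_part_le m f y : `|right_part m f y| <= `|f y|.
Proof. by rewrite /right_part; case: ifP; rewrite ?normr0. Qed.

(** The two bracketed differences are nonnegative and telescope along the gap,
    which is why the step is bounded in this form. *)
Lemma maximal_step_in_gap f m n x :
    (forall y, `|f y| <= 1) -> (forall y, m <= y <= m + n%:Z -> f y = 0) ->
    m <= x < m + n%:Z ->
  `|fdiff 1 (centered_maximal f) x| <=
    (centered_maximal (left_part m f) x
       - centered_maximal (left_part m f) (x + 1)) +
    (centered_maximal (right_part (m + n%:Z) f) (x + 1)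
       - centered_maximal (right_part (m + n%:Z) f) x) +
    n.+1%:R^-1.
Proof.
move=> f1 f0 xmn; set fL := left_part m f; set fQ := right_part _ f.
set L := centered_maximal fL; set Q := centered_maximal fQ.
have fLf y : `|fL y| <= `|f y| := left_part_le m f y.
have fQf y : `|fQ y| <= `|f y| := right_part_le (m + n%:Z) f y.
have fL1 y : `|fL y| <= 1 by exact: le_trans (fLf y) _.
have fQ1 y : `|fQ y| <= 1 by exact: le_trans (fQf y) _.
have Lf z : L z <= centered_maximal f z by exact: le_centered_maximal.
have Qf z : Q z <= centered_maximal f z by exact: le_centered_maximal.
have L_dec : L (x + 1) <= L x.
  apply: (@centered_maximal_right_of_support _ m) => //; last by lia.
  by move=> y my; rewrite /fL /left_part ifF//; lia.
have Q_inc : Q x <= Q (x + 1).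
  apply: (@centered_maximal_left_of_support _ (m + n%:Z)) => //; last by lia.
  by move=> y my; rewrite /fQ /right_part ifF//; lia.
have n_gt0 : 0 <= n.+1%:R^-1 :> R by rewrite invr_ge0.
(* an interval that stays below m + n only sees fL, one that stays above m
   only sees fQ, and any other one has length greater than n *)
have trichotomy z r : m <= z <= m + n%:Z ->
    [\/ centered_avg f z r <= L z, centered_avg f z r <= Q z |
        (r.*2.+1)%:R^-1 <= n.+1%:R^-1 :> R].
  move=> zmn; have [zr|zr] := leP (z + r%:Z) (m + n%:Z).
    apply: Or31; apply: le_trans (centered_avg_le_maximal z r fL1).
    apply: le_centered_avg => y yr; rewrite /fL /left_part; case: ltP => // my.
    by rewrite f0//; lia.
  have [zr'|zr'] := leP m (z - r%:Z).
    apply: Or32; apply: le_trans (centered_avg_le_maximal z r fQ1).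
    apply: le_centered_avg => y yr; rewrite /fQ /right_part; case: ltP => // my.
    by rewrite f0//; lia.
  by apply: Or33; rewrite lef_pV2 ?posrE ?ltr0n// ler_nat; lia.
have lip r := centered_avg_lipschitz x r f1.
set e := n.+1%:R^-1 in n_gt0 trichotomy *; clearbody e.
rewrite fdiff1 ler_norml; apply/andP; split.
  rewrite lerNl opprB lerBlDr; apply: centered_maximal_le => r.
  move: (lip r) (trichotomy x r) (Lf (x + 1)) (Qf (x + 1)).
  move: (centered_avg_le_maximal (x + 1) r f1).
  set d := (r.*2.+1)%:R^-1; clearbody d.
  rewrite distrC => ? /(le_trans (ler_norm _)) ? tri ? ?.
  have {}/tri : m <= x <= m + n%:Z by lia.
  by case=> ?; lra.
rewrite lerBlDr; apply: centered_maximal_le => r.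
move: (lip r) (trichotomy (x + 1) r) (Lf x) (Qf x).
move: (centered_avg_le_maximal x r f1).
set d := (r.*2.+1)%:R^-1; clearbody d.
move=> ? /(le_trans (ler_norm _)) ? tri ? ?.
have {}/tri : m <= x + 1 <= m + n%:Z by lia.
by case=> ?; lra.
Qed.

Lemma variation_in_gap f m n :
    (forall y, `|f y| <= 1) -> (forall y, m <= y <= m + n%:Z -> f y = 0) ->
  \sum_(i < n) `|fdiff 1 (centered_maximal f) (m + i%:Z)| <= 3.
Proof.
move=> f1 f0.
set fL := left_part m f; set fQ := right_part (m + n%:Z) f.
pose L := centered_maximal fL; pose Q := centered_maximal fQ.
have fL1 y : `|fL y| <= 1 := le_trans (left_part_le m f y) (f1 y).
have fQ1 y : `|fQ y| <= 1 := le_trans (right_part_le (m + n%:Z) f y) (f1 y).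
have step i : (i < n)%N -> `|fdiff 1 (centered_maximal f) (m + i%:Z)| <=
    L (m + i%:Z) - L (m + i%:Z + 1) + (Q (m + i%:Z + 1) - Q (m + i%:Z))
      + n.+1%:R^-1.
  by move=> ltin; apply: maximal_step_in_gap => //; lia.
have : n%:R / n.+1%:R <= 1 :> R.
  by rewrite ler_pdivrMr ?ltr0n// mul1r ler_nat.
set e := n.+1%:R^-1 in step *; clearbody e => ne.
pose h (i : nat) := Q (m + i%:Z) - L (m + i%:Z).
apply: (@le_trans _ _ (\sum_(i < n) ((h i.+1 - h i) + e))).
  apply: ler_sum => i _.
  apply: le_trans (step i (ltn_ord i)) _.
  have -> : m + i%:Z + 1 = m + i.+1%:Z by lia.
  by rewrite /h; lra.
rewrite big_split /= -(big_mkord xpredT (fun i => h i.+1 - h i)).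
rewrite telescope_sumr// sumr_const card_ord -[_ *+ n]mulr_natl.
rewrite /h.
move: (centered_maximal_ge0 (m + n%:Z) fL1).
move: (centered_maximal_ge0 (m + 0%N%:Z) fQ1).
move: (centered_maximal_le1 (m + n%:Z) fQ1).
move: (centered_maximal_le1 (m + 0%N%:Z) fL1).
rewrite -/L -/Q; lra.
Qed.

End MaximalFunction.

(** * Variation of the maximal function of a characteristic function *)

Section CharacteristicFunctions.
Context {R : realType}.
Implicit Types (A : set int) (m x y : int) (n k : nat).

Lemma indic_norm_le1 A x : `|\1_A x : R| <= 1.
Proof. by rewrite indicE normr_nat lern1 leq_b1. Qed.

Lemma indic_int A x : (\1_A x : R) \is a Num.int.
Proof. by rewrite indicE rpred_nat. Qed.

Lemma fdiff1_indic A x : `|fdiff 1 (\1_A : int -> R) x| = 0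
  \/ `|fdiff 1 (\1_A : int -> R) x| = 1.
Proof.
rewrite fdiff1 !indicE; case: (_ \in _); case: (_ \in _) => /=.
- by left; rewrite subrr normr0.
- by right; rewrite subr0 normr1.
- by right; rewrite sub0r normrN normr1.
- by left; rewrite subrr normr0.
Qed.

(** Gluing estimate: v is the indicator of the jumps, and w is summed run by
    run.  Each jump i costs at most 1 for w i, and at most K for the run that
    it closes; the last run accounts for the remaining K. *)
Lemma sum_by_runs (v w : nat -> R) (K : R) n :
    (forall i, v i = 0 \/ v i = 1) -> (forall i, w i <= 1) ->
    (forall j l, (j <= l)%N -> (forall i, (j <= i < l)%N -> v i = 0) ->
       \sum_(j <= i < l) w i <= K) ->
  \sum_(0 <= i < n) w i <= (K + 1) * (\sum_(0 <= i < n) v i) + K.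
Proof.
move=> v01 w1 runs.
(* j is the start of the last jump-free run, whose cost is left pending *)
suff [j [lejn v0]] : exists j, [/\ (j <= n)%N,
    (forall i, (j <= i < n)%N -> v i = 0) &
    \sum_(0 <= i < n) w i <=
      (K + 1) * (\sum_(0 <= i < n) v i) + \sum_(j <= i < n) w i].
  by move=> /le_trans; apply; rewrite lerD2l runs.
elim: n => [|n [j [lejn v0 IHn]]].
  by exists 0%N; split=> //; rewrite !big_geq// mulr0 addr0.
have [vn|vn] := v01 n.
  exists j; split; [by rewrite ltnW| |].
    move=> i /andP[ji]; rewrite ltnS leq_eqVlt => /predU1P[->//|ltin].
    by apply: v0; rewrite ji.
  rewrite !big_nat_recr//= vn addr0 addrA lerD2r; exact: IHn.
exists n.+1; split=> //; first by move=> i; lia.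
rewrite [X in _ + X]big_geq// addr0 !big_nat_recr//= vn mulrDr mulr1.
by rewrite addrA lerD//; apply: le_trans IHn _; rewrite lerD2l runs.
Qed.

(** Without jumps, the window lies either in A, where the maximal function
    is 1, or in a gap of A. *)
Lemma variation_in_run A m n :
    (forall i, (i < n)%N -> `|fdiff 1 (\1_A : int -> R) (m + i%:Z)| = 0) ->
  \sum_(i < n) `|fdiff 1 (centered_maximal (\1_A : int -> R)) (m + i%:Z)| <= 3.
Proof.
move=> A0; have A1 := @indic_norm_le1 A.
have Ac : forall i, (i <= n)%N -> \1_A (m + i%:Z) = \1_A m :> R.
  apply: constant_run => i /A0/eqP.
  by rewrite normr_eq0 fdiff1 subr_eq0 => /eqP.
have [mA|mA] := boolP (m \in A).
  rewrite big1// => i _; rewrite fdiff1.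
  have -> : m + i%:Z + 1 = m + i.+1%:Z by lia.
  rewrite !centered_maximal_eq1 ?subrr ?normr0//.
    by rewrite Ac ?indicE ?mA// ltnW.
  by rewrite Ac ?indicE ?mA.
apply: variation_in_gap => // y ymn.
have -> : y = m + `|y - m|%N%:Z by lia.
by rewrite Ac ?indicE ?(negPf mA)//; lia.
Qed.

Lemma variation_centered_maximal_indic A m n :
  \sum_(i < n) `|fdiff 1 (centered_maximal (\1_A : int -> R)) (m + i%:Z)| <=
  4 * (\sum_(i < n) `|fdiff 1 (\1_A : int -> R) (m + i%:Z)|) + 3.
Proof.
pose v i := `|fdiff 1 (\1_A : int -> R) (m + i%:Z)|.
pose w i := `|fdiff 1 (centered_maximal (\1_A : int -> R)) (m + i%:Z)|.
have A1 := @indic_norm_le1 A.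
rewrite -(big_mkord xpredT w) -(big_mkord xpredT v).
have -> : 4 = 3 + 1 :> R by lra.
apply: sum_by_runs => [i|i|j l lejl v0]; first exact: fdiff1_indic.
  rewrite /w fdiff1 ler_norml.
  move: (centered_maximal_ge0 (m + i%:Z) A1).
  move: (centered_maximal_le1 (m + i%:Z) A1).
  move: (centered_maximal_ge0 (m + i%:Z + 1) A1).
  move: (centered_maximal_le1 (m + i%:Z + 1) A1).
  by move=> *; apply/andP; split; lra.
rewrite -{1}[j]add0n big_addn big_mkord.
under eq_bigr => i _.
  rewrite /w; have -> : m + (i + j)%N%:Z = m + j%:Z + i%:Z by lia.
  over.
apply: variation_in_run => i ltij.
by have := v0 (j + i)%N; rewrite /v PoszD addrA; apply; lia.
Qed.

Lemma finite_jump A : finite_set A -> A !=set0 ->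
  exists b, `|fdiff 1 (\1_A : int -> R) b| = 1.
Proof.
move=> /finite_seqP[s As] [a aA].
have [l lA] : exists l : nat, a + l%:Z \notin A.
  exists (\max_(x <- s) `|x| + `|a|).+1%N.
  apply/negP; rewrite As inE /= => als.
  have := @leq_bigmax_seq _ s xpredT (fun x : int => `|x|%N) _ als isT.
  by move: (\max_(x <- s) _)%N => N; lia.
have [[|l'] l'A l'min] := ex_minnP (ex_intro (fun l => a + l%:Z \notin A) l lA).
  by move: l'A; rewrite addr0 mem_set.
exists (a + l'%:Z); rewrite fdiff1.
have -> : a + l'%:Z + 1 = a + l'.+1%:Z by lia.
rewrite !indicE (negPf l'A); have [_|aA'] := boolP (_ \in A).
  by rewrite sub0r normrN normr1.
by have := l'min _ aA'; rewrite ltnn.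
Qed.

Lemma powR_ge1 (a p : R) : 1 <= a -> 0 <= p -> 1 <= a `^ p.
Proof. by move=> a1 p0; rewrite -(powRr0 a) ler_powR. Qed.

(** A jump cannot be followed by a run of 2 ^ k + 1 zeros of the difference of
    order k + 1, and a nonzero value of that difference is a nonzero integer. *)
Lemma fdiff1_le_window k (p : R) (f : int -> R) b : 0 < p ->
    (forall y, `|f y| <= 1) -> (forall y, f y \is a Num.int) ->
    `|fdiff 1 f b| <= 1 ->
  `|fdiff 1 f b| <= \sum_(i < (2 ^ k).+1) `|fdiff k.+1 f (b + i%:Z)| `^ p.
Proof.
move=> p_gt0 f1 fZ fb.
have [[i fi]|all0] := pselect (exists i : 'I_(2 ^ k).+1,
    fdiff k.+1 f (b + i%:Z) != 0).
  apply: le_trans fb _; rewrite (bigD1 i)//= ler_wpDr ?sumr_ge0//.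
  have f_ge1 := norm_intr_ge1 (fdiff_int k.+1 _ fZ) fi.
  by apply: powR_ge1 => //; exact: ltW.
have := @fdiff_vanish_run R k (2 ^ k).+1 f b f1 fZ (leqnn _) _ 0%N isT.
rewrite addr0 => ->; first by rewrite normr0 sumr_ge0// => ? _; exact: powR_ge0.
move=> i ltik; apply/eqP/negP => /negP fi; apply: all0.
by exists (Ordinal ltik).
Qed.

Lemma sum_fdiff1_le_powR k (p : R) (f : int -> R) (T : R) : 0 < p ->
    (forall y, `|f y| <= 1) -> (forall y, f y \is a Num.int) ->
    (forall y, `|fdiff 1 f y| <= 1) ->
    (forall m n, \sum_(i < n) `|fdiff k.+1 f (m + i%:Z)| `^ p <= T) ->
  forall m n, \sum_(i < n) `|fdiff 1 f (m + i%:Z)| <= (2 ^ k).+1%:R * T.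
Proof.
move=> p0 f1 fZ f'1 fT m n.
apply: (le_trans (ler_sum _ (fun i _ => fdiff1_le_window k p0 f1 fZ (f'1 _)))).
rewrite exchange_big /= mulr_natl -[X in T *+ X]card_ord -sumr_const.
apply: ler_sum => i _; apply: le_trans (fT (m + i%:Z) n).
by apply: ler_sum => j _; rewrite addrAC.
Qed.

Lemma powR_le_linear (B t p : R) : 1 <= B -> 1 <= p -> 0 <= t <= B ->
  t `^ p <= B `^ p * t.
Proof.
move=> B1 p1 /andP[t0 tB]; have p0 : 0 <= p by apply: le_trans p1.
have Bp1 : 1 <= B `^ p.
  exact: powR_ge1.
have [t1|/ltW t1] := leP t 1.
  apply: (@le_trans _ _ t); last by rewrite ler_peMl.
  move: t0; rewrite le_eqVlt => /predU1P[<-|t0].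
    by rewrite powR0// gt_eqF// (lt_le_trans _ p1).
  by rewrite ge1r_powR// t0.
apply: (@le_trans _ _ (B `^ p)); last by rewrite ler_peMr// powR_ge0.
by rewrite ge0_ler_powR ?nnegrE// (le_trans _ B1).
Qed.

(** The three factors come from passing from exponent 1 to p, from order 1
    to k + 1 on the side of the maximal function, and from order k + 1 back to
    order 1 on the side of the characteristic function. *)
Definition growth_const k (p : R) : R :=
  (2 ^+ k.+1) `^ p * (2 ^+ k * (4 * (2 ^ k).+1%:R + 3)).

Lemma growth_const_gt0 k p : 0 < growth_const k p.
Proof. by rewrite !mulr_gt0 ?powR_gt0 ?exprn_gt0 ?addr_gt0 ?mulr_gt0. Qed.

Lemma sum_powR_fdiff_maximal_le A k (p T : R) : finite_set A -> A !=set0 ->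
    1 <= p ->
    (forall m n, \sum_(i < n) `|fdiff k.+1 (\1_A : int -> R) (m + i%:Z)| `^ p
       <= T) ->
  forall m n,
    \sum_(i < n)
      `|fdiff k.+1 (centered_maximal (\1_A : int -> R)) (m + i%:Z)| `^ p
    <= growth_const k p * T.
Proof.
move=> fA A0 p1 AT; have p0 : 0 < p by apply: lt_le_trans p1.
have A1 := @indic_norm_le1 A; have AZ := @indic_int A.
have A'1 y : `|fdiff 1 (\1_A : int -> R) y| <= 1.
  by have [->|->] := fdiff1_indic A y.
(* T bounds the contribution of at least one jump; this absorbs the additive
   constant of the variation estimate *)
have T_ge1 : 1 <= T.
  have [b b1] := finite_jump fA A0.
  rewrite -[leLHS]b1; apply: le_trans (fdiff1_le_window k p0 A1 AZ (A'1 b)) _.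
  exact: AT.
have M1 y : `|centered_maximal (\1_A : int -> R) y| <= 1.
  by rewrite ger0_norm ?centered_maximal_ge0 ?centered_maximal_le1.
have var := @variation_centered_maximal_indic A.
have {}var m n : \sum_(i < n)
    `|fdiff 1 (centered_maximal (\1_A : int -> R)) (m + i%:Z)| <=
    (4 * (2 ^ k).+1%:R + 3) * T.
  apply: le_trans (var m n) _; rewrite [leRHS]mulrDl -mulrA lerD ?ler_peMr//.
  by rewrite ler_wpM2l// (sum_fdiff1_le_powR p0 A1 AZ).
move=> m n; apply: (@le_trans _ _ (\sum_(i < n) (2 ^+ k.+1) `^ p *
    `|fdiff k.+1 (centered_maximal (\1_A : int -> R)) (m + i%:Z)|)).
  apply: ler_sum => i _; apply: powR_le_linear => //.
    by rewrite exprn_ege1// ler1n.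
  by rewrite normr_ge0 fdiff_bound.
rewrite -mulr_sumr /growth_const -!mulrA ler_wpM2l ?powR_ge0//.
exact: sum_fdiff_le.
Qed.

End CharacteristicFunctions.

(** * Norms for the counting measure on the integers *)

Section CountingNorms.
Context {R : realType}.
Implicit Types (A : set int) (m x y : int) (n k : nat) (f : int -> R).
Local Notation mu := (@counting int R).

Lemma counting_set1 x : mu [set x] = 1%E.
Proof. by rewrite /counting asboolT// fset_set1 finmap.cardfs1. Qed.

Definition window m n : set int := [set x | m <= x < m + n%:Z].

Lemma integral_window f m n : (forall y, 0 <= f y) ->
  (\int[mu]_(x in window m n) (f x)%:E = (\sum_(i < n) f (m + i%:Z))%:E)%E.
Proof.
move=> f0.
have -> : window m n = \big[setU/set0]_(i < n) [set m + i%:Z].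
  rewrite -(bigcup_mkord n (fun i => [set m + i%:Z])).
  apply/seteqP; split => [x|x [i /= ltin ->]]; rewrite /window /=; last by lia.
  by move=> xmn; exists `|x - m|%N => /=; lia.
rewrite ge0_integral_bigsetU//.
- rewrite -sumEFin; apply: eq_bigr => i _.
  rewrite (eq_integral (cst (f (m + i%:Z))%:E)).
    by rewrite integral_cst// [X in (_ * X)%E]counting_set1 mule1.
  by move=> x /[!inE] ->.
- exact: index_enum_uniq.
- by move=> i j _ _ [x [/= -> /addrI [/val_inj]]].
- by move=> x _; rewrite lee_fin.
Qed.

Lemma sum_le_integral_counting f m n : (forall y, 0 <= f y) ->
  ((\sum_(i < n) f (m + i%:Z))%:E <= \int[mu]_x (f x)%:E)%E.
Proof.
move=> f0; rewrite -integral_window//; apply: ge0_subset_integral => //.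
by move=> x _; rewrite lee_fin.
Qed.

Lemma integral_counting_le f (c : R) : (forall y, 0 <= f y) ->
  (forall m n, \sum_(i < n) f (m + i%:Z) <= c) ->
  (\int[mu]_x (f x)%:E <= c%:E)%E.
Proof.
move=> f0 fc; pose F i := window (- i%:Z) (i.*2.+1).
have -> : [set: int] = \bigcup_i F i.
  apply/seteqP; split=> x // _; exists `|x|%N => //=.
  by rewrite /F /window /=; lia.
have cF : (\int[mu]_(x in F i) (f x)%:E @[i --> \oo] -->
           \int[mu]_(x in \bigcup_i F i) (f x)%:E)%E.
  apply: ge0_nondecreasing_set_cvg_integral => //.
  - apply/nondecreasing_seqP => i; apply/subsetPset => x.
    by rewrite /F /window /=; lia.
  - by move=> i x _; rewrite lee_fin.
rewrite -(cvg_lim _ cF)//; apply: lime_le.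
  by apply/cvg_ex; eexists; exact: cF.
by apply: nearW => i; rewrite integral_window// lee_fin.
Qed.

(** The only set that is null for the counting measure is the empty one. *)
Lemma ae_counting (P : int -> Prop) : (\forall x \ae mu, P x) -> forall x, P x.
Proof.
move=> [N [_ N0 PN]] x; apply: contrapT => Px.
have : (mu [set x] <= mu N)%E.
  by apply: le_measure; rewrite ?inE// => _ ->; exact: PN.
by rewrite [X in (X <= _)%E]counting_set1 [X in (_ <= X)%E]N0 lee_fin ler10.
Qed.

Lemma counting_setT_gt0 : (0 < mu [set: int])%E.
Proof.
apply: (@lt_le_trans _ _ (mu [set 0])); first by rewrite counting_set1 lte_fin.
by apply: le_measure; rewrite ?inE.
Qed.

Lemma lpnorm_pinfty_le f (c : R) : (forall x, `|f x| <= c) ->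
  (lpnorm +oo f <= c%:E)%E.
Proof.
move=> fc; rewrite /lpnorm unlock counting_setT_gt0.
by apply/ess_supP; apply: nearW => x /=; rewrite lee_fin.
Qed.

Lemma le_lpnorm_pinfty f x : (`|f x|%:E <= lpnorm +oo f)%E.
Proof.
rewrite /lpnorm unlock counting_setT_gt0.
by have := ae_counting (ess_sup_ge mu (abse \o (EFin \o f))); apply.
Qed.

Lemma lpnorm0 (p : \bar R) : (1 <= p)%E -> lpnorm p (fun=> 0 : R) = 0%E.
Proof.
move=> p1; rewrite /lpnorm; apply: Lnorm0.
by rewrite gt_eqF// (lt_le_trans _ p1).
Qed.

Lemma lpnormE (p : R) f :
  lpnorm p%:E f = poweR (\int[mu]_x (`|f x| `^ p)%:E)%E p^-1.
Proof. by rewrite /lpnorm unlock. Qed.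

(** Comparing power sums over all finite windows suffices.  The bound T is
    only asked to dominate the windows of f; it is applied with the integral
    itself when that is finite, the other case being trivial since C > 0. *)
Lemma lpnorm_le (p C : R) f g : 1 <= p -> 0 < C ->
  (forall T, (forall m n, \sum_(i < n) `|f (m + i%:Z)| `^ p <= T) ->
     forall m n, \sum_(i < n) `|g (m + i%:Z)| `^ p <= C * T) ->
  (lpnorm p%:E g <= (C `^ p^-1)%:E * lpnorm p%:E f)%E.
Proof.
move=> p1 C0 fg; have p0 : 0 < p by exact: lt_le_trans p1.
have If0 : (0 <= \int[mu]_x (`|f x| `^ p)%:E)%E.
  by apply: integral_ge0 => x _; rewrite lee_fin powR_ge0.
rewrite !lpnormE.
have [Ify|Ifin] := eqVneq (\int[mu]_x (`|f x| `^ p)%:E)%E +oo%E.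
  rewrite Ify poweRyr ?gt_eqF ?invr_gt0// gt0_muley ?leey//.
  by rewrite lte_fin powR_gt0.
have /fineK Ifine : (\int[mu]_x (`|f x| `^ p)%:E)%E \is a fin_num.
  by rewrite ge0_fin_numE// ltey.
set T := fine _ in Ifine.
have Ig : (\int[mu]_x (`|g x| `^ p)%:E <= (C * T)%:E)%E.
  apply: integral_counting_le => [y|]; first exact: powR_ge0.
  apply: fg => m n; rewrite -lee_fin Ifine; apply: sum_le_integral_counting.
  by move=> y; exact: powR_ge0.
have T0 : 0 <= T by rewrite fine_ge0.
rewrite -Ifine -poweR_EFin -poweRM ?lee_fin ?(ltW C0)//.
have -> : (C%:E * T%:E = (C * T)%:E)%E by [].
apply: gt0_ler_poweR Ig => //; first by rewrite invr_ge0 ltW.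
  rewrite in_itv /= leey andbT; apply: integral_ge0 => x _.
  by rewrite lee_fin powR_ge0.
by rewrite in_itv /= leey lee_fin mulr_ge0// ltW.
Qed.

End CountingNorms.

Lemma fdiff_cst0 (R : realType) k (x : int) : fdiff k (fun=> 0 : R) x = 0.
Proof. by rewrite /fdiff big1// => i _; rewrite mulr0. Qed.

Lemma centered_maximal_cst0 (R : realType) :
  centered_maximal (fun=> 0 : R) = fun=> 0.
Proof.
apply/funext => x; apply/eqP; rewrite eq_le.
rewrite centered_maximal_ge0; last by move=> y; rewrite normr0.
rewrite andbT; apply: centered_maximal_le => r.
by rewrite /centered_avg big1 ?mulr0// => i _; rewrite normr0.
Qed.

Theorem corollary2 (R : realType) (k : nat) (hk : (1 <= k)%N)
    (p : \bar R) (hp : (1 <= p)%E) :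
  exists C : R, forall A : set int, finite_set A ->
    (lpnorm p (fdiff k (centered_maximal (\1_A : int -> R)))
       <= C%:E * lpnorm p (fdiff k (\1_A : int -> R)))%E.
Proof.
case: k hk => // k _.
suff [C [C0 hC]] : exists C : R, 0 <= C /\ forall A, finite_set A -> A !=set0 ->
    (lpnorm p (fdiff k.+1 (centered_maximal (\1_A : int -> R)))
       <= C%:E * lpnorm p (fdiff k.+1 (\1_A : int -> R)))%E.
  exists C => A fA; have [->|/set0P A0] := eqVneq A set0; last exact: hC.
  have -> : (\1_set0 : int -> R) = fun=> 0 by rewrite indic0.
  rewrite centered_maximal_cst0.
  have -> : fdiff k.+1 (fun=> 0) = (fun=> 0) :> (int -> R).
    by apply/funext => x; exact: fdiff_cst0.
  by rewrite lpnorm0// mule0.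
case: p hp => [p||//]; rewrite ?lee_fin => p1.
  exists (growth_const k p `^ p^-1); split; first exact: powR_ge0.
  move=> A fA A0; apply: lpnorm_le => //; first exact: growth_const_gt0.
  by move=> T; exact: sum_powR_fdiff_maximal_le.
exists (2 ^+ k.+1); split=> // A fA A0.
have A1 := @indic_norm_le1 R A.
apply: (@le_trans _ _ (2 ^+ k.+1)%:E%E).
  apply: lpnorm_pinfty_le => x; apply: fdiff_bound => y.
  by rewrite ger0_norm ?centered_maximal_ge0 ?centered_maximal_le1.
rewrite -[leLHS]mule1 lee_wpmul2l ?lee_fin//.
have [x fx] : exists x, fdiff k.+1 (\1_A : int -> R) x != 0.
  apply: contrapT => f0; have [b b1] := finite_jump (R := R) fA A0.
  have := @fdiff_vanish_run R k (2 ^ k).+1 _ b A1 (@indic_int R A) (leqnn _) _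
    0%N isT.
  rewrite addr0 => fb0; move: b1; rewrite fb0 ?normr0 => [/esym/eqP|i _].
    by rewrite oner_eq0.
  by apply/eqP/negP => /negP fi; apply: f0; eexists; exact: fi.
apply: le_trans (le_lpnorm_pinfty _ x); rewrite lee_fin.
exact: norm_intr_ge1 (fdiff_int k.+1 x (@indic_int R A)) fx.
Qed.
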